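(* Let $N\in\mathbb{N}$ and $1\le s\le N$, and let $f_{s,N}$ be the smallest value of $r(S)$ over all subsets $S\subseteq[1,N]$ with $|S|=s$. Then $$f_{s,N}=\begin{cases}0, & s\le\frac{N+1}{2},\\[2pt] \frac{(2s-N)(2s-N-1)}{2}, & s>\frac{N+1}{2}.\end{cases}$$
   Context: $\mathbb{N}$ denotes the positive integers. For integers $a\le b$, $[a,b]$ denotes the set of integers $x$ with $a\le x\le b$. For a finite set $S\subseteq\mathbb{N}$, $r(S)=|\{(x,y)\in S^2: x+y\in S\}|$ (ordered pairs, $x=y$ allowed). *)

(* Defs.v *)
From mathcomp Require Import all_boot all_order all_algebra.
From mathcomp Require Import finmap.

Set Implicit Arguments.
Unset Strict Implicit.
Unset Printing Implicit Defensive.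

Local Open Scope nat_scope.

Definition r (S : {fset nat}) : nat :=
  #|` [fset p in S `*` S | (p.1 + p.2)%N \in S]%fset|.

Definition admissible (s N : nat) (S : {fset nat}) : Prop :=
  (forall x : nat, x \in S -> 1 <= x <= N) /\ #|` S| = s.

(* The graph of (s, N) |-> f_{s,N}: the minimum is attained and is a lower
   bound, hence [m] is unique. *)
Definition is_f (s N m : nat) : Prop :=
  (exists2 S : {fset nat}, admissible s N S & r S = m) /\
  (forall S : {fset nat}, admissible s N S -> m <= r S).

(* Main.v *)
Require Import Defs.
From mathcomp Require Import all_boot all_order all_algebra.
From mathcomp Require Import finmap.
From mathcomp Require Import zify ring.

(** If [n] is the maximum of [S] and [A] is [S] without [n], then [r S] exceeds
    [r A] by the number of representations of [n] as a sum of two elements of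
    [A], that is by the size of [A ∩ (n - A)].  Both sets lie in [[1, n-1]], so
    by inclusion-exclusion this is at least [2 |A| - (n - 1)].  Induction on the
    ambient [N] turns this into [r S >= 'C(2 |S| - N, 2)]; the interval
    [[N-s+1, N]] attains equality at each step. *)

Import Order.TTheory GRing.Theory Num.Theory.

Local Open Scope fset_scope.
Local Open Scope nat_scope.

(** An ordered representation of [n] is recorded by its first summand. Truncated subtraction is
    harmless, since every use has [A] below [n]. *)
Definition reps (A : {fset nat}) (n : nat) : {fset nat} :=
  [fset x in A | n - x \in A].

Definition interval (a b : nat) : {fset nat} := [fset x in index_iota a b.+1].

Lemma in_interval (a b x : nat) : (x \in interval a b) = (a <= x <= b).
Proof. by rewrite !inE /= mem_index_iota ltnS. Qed.

Lemma card_interval (a b : nat) : #|` interval a b| = b.+1 - a.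
Proof. by rewrite card_fseq undup_id ?iota_uniq // size_iota. Qed.

(** A pair with [n] as a summand has a sum above [n], hence outside the set, so the only new pairs
    are those of [A] with sum exactly [n]. *)
Lemma r_fsetU1 (A : {fset nat}) (n : nat) :
  0 < n -> {in A, forall x, 1 <= x < n} -> r (n |` A) = r A + #|` reps A n|.
Proof.
move=> n_gt0 An.
have -> : #|` reps A n| = #|` [fset (x, n - x) | x in reps A n]|.
  by rewrite [RHS]card_imfset // => x y [].
(* The two families of pairs are disjoint: sums lying in [A] are below [n]. *)
rewrite /r -cardfsUI [X in _ + X](_ : _ = 0) ?addn0; last first.
  apply/eqP; rewrite cardfs_eq0; apply/eqP/fsetP => -[x y].
  rewrite [RHS]inE; apply/negP; rewrite inE => /andP[+ /imfsetP[z /= +]].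
  rewrite !inE /= => /andP[_ xyA] /andP[zA _] [xz yz].
  by have := An _ xyA; have := An _ zA; lia.
congr (#|` _|); apply/fsetP => -[x y].
rewrite [RHS]in_fsetU.
have -> : ((x, y) \in [fset (x, n - x) | x in reps A n]) =
          [&& x \in A, y \in A & x + y == n].
  apply/imfsetP/and3P => /= [[z]|[xA yA /eqP xyn]].
    rewrite !inE /= => /andP[zA nzA] [-> ->].
    by split=> //; have := An _ zA; lia.
  have yE : y = n - x by lia.
  by exists x; rewrite ?yE // !inE /= xA -yE.
rewrite !inE /=; have := An x; have := An y; have := An (x + y).
case: (x \in A); case: (y \in A); case: (x + y \in A); lia.
Qed.

Lemma card_reps_ge (A : {fset nat}) (n : nat) :
  {in A, forall x, 1 <= x < n} -> 2 * #|` A| - n.-1 <= #|` reps A n|.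
Proof.
move=> An; pose B := [fset n - x | x in A].
have cardB : #|` B| = #|` A|.
  by rewrite card_in_imfset // => x y /An xn /An yn; lia.
have -> : reps A n = A `&` B.
  apply/fsetP => x; rewrite !inE /=; have [xA|//] := boolP (x \in A).
  apply/idP/imfsetP => /= [nxA|[y yA xE]].
    by exists (n - x) => //; have := An _ xA; lia.
  by rewrite (_ : n - x = y) //; have := An _ yA; lia.
have : #|` A `|` B| <= #|` interval 1 n.-1|.
  apply/fsubset_leq_card/fsubsetP => x; rewrite in_interval !inE.
  by case/orP=> [/An|/imfsetP[y /= /An + ->]]; lia.
by have := cardfsUI A B; rewrite card_interval cardB; lia.
Qed.

(** Raising both [k] and [N] by one raises [2 * k - N] by one, so this is Pascal's rule; if
    [2 * k < N], truncation makes the left side zero. *)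
Lemma bin2_step (k N p q : nat) :
  'C(2 * k - N, 2) <= p -> 2 * k - N <= q -> 'C(2 * k.+1 - N.+1, 2) <= p + q.
Proof.
have [lt|ge] := ltnP N (2 * k).+1; last by rewrite !bin_small; lia.
by rewrite (_ : 2 * k.+1 - _ = (2 * k - N).+1) ?binS ?bin1; lia.
Qed.

Lemma r_ge (N : nat) (S : {fset nat}) :
  {in S, forall x, 1 <= x <= N} -> 'C(2 * #|` S| - N, 2) <= r S.
Proof.
elim: N S => [|N IHN] S SN.
  have -> : S = fset0.
    by apply/fsetP => x; rewrite inE; apply/negP => /SN; lia.
  by rewrite cardfs0.
have [NS|NS] := boolP (N.+1 \in S); last first.
  (* Here [S] already lies in the smaller ambient interval, where the bound is at least as
     strong. *)
  apply: leq_trans (IHN S _); first by apply: leq_bin2l; lia.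
  move=> x xS; have := SN _ xS.
  by have : x != N.+1 by [apply: contraNneq NS => <-]; lia.
pose A := S `\ N.+1.
have AN : {in A, forall x, 1 <= x < N.+1}.
  by move=> x; rewrite !inE => /andP[xN /SN]; lia.
have -> : #|` S| = #|` A|.+1 by rewrite (cardfsD1 N.+1) NS.
rewrite -(fsetD1K NS) -/A r_fsetU1 //.
exact: bin2_step (IHN A AN) (card_reps_ge _ _ AN).
Qed.

Lemma r_interval (a N : nat) : 0 < a -> r (interval a N) = 'C(N.+2 - 2 * a, 2).
Proof.
move=> a_gt0; elim: N => [|N IHN].
  rewrite bin_small; last by lia.
  apply/eqP; rewrite cardfs_eq0; apply/eqP/fsetP => -[x y].
  by rewrite !inE /= !mem_index_iota; lia.
have [lt|ge] := ltnP N.+1 a.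
  rewrite bin_small; last by lia.
  apply/eqP; rewrite cardfs_eq0; apply/eqP/fsetP => -[x y].
  by rewrite !inE /= !mem_index_iota; lia.
have -> : interval a N.+1 = N.+1 |` interval a N.
  by apply/fsetP => x; rewrite !inE /= !mem_index_iota; lia.
rewrite r_fsetU1 //; last by move=> x; rewrite in_interval; lia.
(* The condition [N.+1 - x >= a] caps [x] at [N.+1 - a], which is at most [N] because [a] is
   positive. *)
have -> : reps (interval a N) N.+1 = interval a (N.+1 - a).
  by apply/fsetP => x; rewrite !inE /= !mem_index_iota; lia.
rewrite IHN card_interval.
have [le|gt] := leqP (2 * a) N.+2; last by rewrite !bin_small; lia.
by rewrite (_ : N.+3 - _ = (N.+2 - 2 * a).+1) ?binS ?bin1; lia.
Qed.

Lemma is_f_bin (N s : nat) : s <= N -> is_f s N 'C(2 * s - N, 2).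
Proof.
move=> sN; split; last by move=> S [SN <-]; exact: r_ge.
(* The top [s] integers; with [a = N - s + 1], [N + 2 - 2 * a] becomes [2 * s - N]. *)
exists (interval (N - s).+1 N); last by rewrite r_interval //; congr 'C(_, _); lia.
split; last by rewrite card_interval; lia.
by move=> x; rewrite in_interval; lia.
Qed.

Lemma bin2_rat (n : nat) : ('C(n, 2)%:R = n%:R * (n%:R - 1) / 2 :> rat)%R.
Proof.
elim: n => [|n IHn]; first by rewrite bin_small // mul0r mul0r.
by rewrite binS bin1 natrD IHn -natr1; field.
Qed.

Local Open Scope ring_scope.

Theorem theorem3p3 (N s : nat) (hN : (1 <= N)%N) (hs : (1 <= s <= N)%N) :
  exists2 f : nat, is_f s N f &
    f%:R = (if (s%:R <= (N%:R + 1) / 2 :> rat) then 0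
            else (2 * s%:R - N%:R) * (2 * s%:R - N%:R - 1) / 2) :> rat.
Proof.
exists 'C(2 * s - N, 2); first by apply: is_f_bin; case/andP: hs.
have -> : (s%:R <= (N%:R + 1) / 2 :> rat) = (s * 2 <= N.+1)%N.
  by rewrite ler_pdivlMr // -natrM natr1 ler_nat.
(* The threshold is [N.+1] rather than [N] because ['C(1, 2)] also vanishes. *)
case: ifP => sN; first by rewrite bin_small //; lia.
by rewrite bin2_rat natrB ?natrM //; lia.
Qed.
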